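(* Let $G$ be a periodic soluble group, and assume that $G$ is not locally nilpotent. Then $G \in \mathcal S$ if and only if $G$ splits as a semidirect product $G = \langle x \rangle \ltimes H$ (with $H$ normal in $G$), where, for some prime $p$, $\langle x \rangle$ is a $p$-group, $H$ is a nilpotent $p'$-group, $x^p$ acts trivially on $H$ by conjugation, and the map $\rho_x \colon H \to H$ has property $(\star)$.
   Context: $\mathcal S$ denotes the class of all groups $G$ such that every non-nilpotent subgroup $K \le G$ satisfies $N_G(K) = K$. Groups may be infinite. A $p'$-group is a periodic group with no elements of order $p$. Given a cyclic group $\langle x\rangle$ acting on a group $H$ by automorphisms $h \mapsto h^x$ (in a semidirect product, $h^x = x^{-1}hx$), write $K \le_x H$ if $K$ is a subgroup of $H$ invariant under $\langle x \rangle$, and define $\rho_x \colon H \to H$ by $\rho_x(h) = [x,h] = (h^{-1})^x h$; $\rho_x^n$ is its $n$-fold iterate. The map $\rho_x$ has property $(\star)$ if for every $K \le_x H$, either there is an integer $n \ge 1$ with $\rho_x^n(K) = 1$, or $\langle \rho_x(K) \rangle = K$. *)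

(* Defs.v *)
From mathcomp Require Import all_boot.
From mathcomp Require Import boolp classical_sets cardinality.

Set Implicit Arguments.
Unset Strict Implicit.
Unset Printing Implicit Defensive.

Local Open Scope classical_set_scope.
Local Open Scope group_scope.

(* Groups are possibly infinite, so the ambient group is a [groupType] and its
   subgroups are propositional sets.  Conjugation [h ^ x] is [x^-1 * (h * x)]
   and the commutator [[~ x, y]] is [x^-1 * y^-1 * x * y]. *)

Section Groups.
Variable G : groupType.
Implicit Types (A B H K : set G) (x g h : G) (p n : nat).

Definition subgroup K : Prop :=
  [/\ K 1, forall g h, K g -> K h -> K (g * h) & forall g, K g -> K g^-1].

Definition generated A : set G := smallest subgroup A.

Definition cyclic_subgroup x : set G := generated [set x].

Definition normal_subgroup H : Prop :=
  subgroup H /\ forall g h, H h -> H (h ^ g).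

(* Only the inclusion of [K ^ g] in [K] would be too weak for infinite [K]. *)
Definition normalizer K : set G := [set g | [set h ^ g | h in K] = K].

Definition commutator_subgroup A B : set G :=
  generated [set [~ a, b] | a in A & b in B].

(* Indexed from 0: [lower_central K 0 = K], [derived_series K 0 = K]. *)
Fixpoint lower_central K n : set G :=
  if n is m.+1 then commutator_subgroup (lower_central K m) K else K.

Fixpoint derived_series K n : set G :=
  if n is m.+1
  then commutator_subgroup (derived_series K m) (derived_series K m) else K.

Definition nilpotent_group K : Prop := exists n, lower_central K n = [set 1].

Definition soluble_group K : Prop := exists n, derived_series K n = [set 1].

Definition locally_nilpotent K : Prop :=
  forall A, finite_set A -> A `<=` K -> nilpotent_group (generated A).

Definition has_order g n : Prop :=
  [/\ (0 < n)%N, g ^+ n = 1 & forall m, (0 < m < n)%N -> g ^+ m <> 1].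

Definition periodic K : Prop := forall g, K g -> exists n, has_order g n.

Definition p_group p K : Prop :=
  forall g, K g -> exists k : nat, has_order g (p ^ k)%N.

Definition p'_group p K : Prop :=
  periodic K /\ forall g, K g -> ~ has_order g p.

(* [G] is the internal semidirect product of [A] and the normal [H]. *)
Definition semidirect A H : Prop :=
  [/\ subgroup A, normal_subgroup H, A `&` H = [set 1]
    & [set a * h | a in A & h in H] = [set: G]].

Definition invariant_subgroup x K H : Prop :=
  [/\ subgroup K, K `<=` H
    & forall y k, cyclic_subgroup x y -> K k -> K (k ^ y)].

(* Convertible to [x^-1 * (h^-1 * (x * h))], i.e. [(h^-1) ^ x * h]; it maps a
   normal subgroup of [G] to itself. *)
Definition rho x h : G := [~ x, h].

Definition property_star x H : Prop :=
  forall K, invariant_subgroup x K H ->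
    (exists2 n, (1 <= n)%N & [set iter n (rho x) k | k in K] = [set 1])
    \/ generated [set rho x k | k in K] = K.

End Groups.

Definition class_S (G : groupType) : Prop :=
  forall K : set G, subgroup K -> ~ nilpotent_group K -> normalizer K = K.

(* Main.v *)
From HB Require Import structures.
Require Import Defs.
From mathcomp Require Import all_boot.
From mathcomp Require Import boolp classical_sets cardinality.

(* Suppose [G] is in the class.  As [G'] is a proper normal subgroup, every
   proper subgroup containing [G'] is nilpotent; by Fitting and the failure of
   local nilpotency, [G = <x> G'] for some [p]-element [x].  Then
   [M = <x^p> G'] is nilpotent; let [H] be the set of its [p']-elements, with
   which [x^p] commutes.  A proper subgroup containing [<x> H] never equals its
   own normalizer, because [x] acts unipotently on the [p]-sections of [M]; with
   Zorn's lemma this yields [G = <x> H].  Property (star) follows from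
   self-normalization applied to [<x> [x, K]], which is normal in [<x> K].

   Conversely a non-nilpotent [K] is not contained in [<x^p> H], which is
   nilpotent, so it contains some [x h] of the order of [x].  This element is
   conjugate to [x], so we may assume that [x] is in [K].  With [N] the
   normalizer of [K] in [H], property (star) for [N] gives
   [N = <rho_x N> <= K], since the other alternative would make [x] centralize
   the intersection of [H] and [K], and [K] nilpotent. *)

Set Implicit Arguments.
Unset Strict Implicit.
Unset Printing Implicit Defensive.

Local Open Scope classical_set_scope.
Local Open Scope group_scope.

(** * Subgroups, lower central series and Fitting's theorem *)

Section Subgroups.
Variable G : groupType.
Implicit Types (A B E H K L N : set G) (g h x y : G) (n : nat).

Lemma sub1 K : subgroup K -> K 1.
Proof. by case. Qed.

Lemma subM K g h : subgroup K -> K g -> K h -> K (g * h).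
Proof. by case=> _ + _; apply. Qed.

Lemma subV K g : subgroup K -> K g -> K g^-1.
Proof. by case=> _ _; apply. Qed.

Lemma subX K g n : subgroup K -> K g -> K (g ^+ n).
Proof.
move=> sK Kg; elim: n => [|n IHn]; first exact: sub1.
by rewrite expgS; apply: subM.
Qed.

Lemma subJ K g h : subgroup K -> K g -> K h -> K (g ^ h).
Proof. by move=> sK Kg Kh; rewrite conjgE; do !apply: subM => //; apply: subV. Qed.

Lemma subMl K g h : subgroup K -> K g -> K (g * h) -> K h.
Proof. by move=> sK Kg Kgh; rewrite -(mulKg g h); apply: subM => //; apply: subV. Qed.

Lemma subMr K g h : subgroup K -> K h -> K (g * h) -> K g.
Proof. by move=> sK Kh Kgh; rewrite -(mulgK h g); apply: subM => //; apply: subV. Qed.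

Lemma subgroupT : subgroup [set: G].
Proof. by []. Qed.

Lemma subgroup1 : subgroup [set 1 : G].
Proof. by split=> [|_ _ -> ->|_ ->] //=; rewrite ?mulg1 ?invg1. Qed.

Lemma subgroupI H K : subgroup H -> subgroup K -> subgroup (H `&` K).
Proof.
move=> sH sK; split=> [|g h [Hg Kg] [Hh Kh]|g [Hg Kg]]; split;
  by [apply: sub1 | apply: subM | apply: subV].
Qed.

Lemma subgroup_generated A : subgroup (generated A).
Proof.
split=> [K [sK _]|g h Ag Ah K sAK|g Ag K sAK]; first exact: sub1.
  by apply: subM; [case: sAK | apply: Ag | apply: Ah].
by apply: subV; [case: sAK | apply: Ag].
Qed.

Lemma sub_generated A : A `<=` generated A.
Proof. exact: sub_gen_smallest. Qed.

Lemma generated_sub A K : subgroup K -> A `<=` K -> generated A `<=` K.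
Proof. exact: smallest_sub. Qed.

(** This is only the inclusion of [K ^ g] in [K], which is easier to propagate through products and
    generators. In a periodic group it amounts to membership in [normalizer K]. *)
Definition normalizes K g := forall h, K h -> K (h ^ g).

Lemma subgroup_preimJ K g : subgroup K -> subgroup [set h | K (h ^ g)].
Proof.
move=> sK; split=> [|h k /= Kh Kk|h /= Kh] /=.
- by rewrite conj1g; apply: sub1.
- by rewrite conjMg; apply: subM.
- by rewrite conjVg; apply: subV.
Qed.

Lemma generated_normalizes A g :
  (forall a, A a -> generated A (a ^ g)) -> normalizes (generated A) g.
Proof.
move=> Ag h; move: h; apply: generated_sub Ag.
exact/subgroup_preimJ/subgroup_generated.
Qed.

Lemma normalizes_self K g : subgroup K -> K g -> normalizes K g.
Proof. by move=> sK Kg h Kh; apply: subJ. Qed.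

Lemma normalizesM K g h : normalizes K g -> normalizes K h -> normalizes K (g * h).
Proof. by move=> Kg Kh k Kk; rewrite conjgM; apply/Kh/Kg. Qed.

Lemma normalizesX K g n : normalizes K g -> normalizes K (g ^+ n).
Proof.
move=> Kg; elim: n => [|n IHn]; first by move=> h; rewrite conjg1.
by rewrite expgS; apply: normalizesM.
Qed.

Lemma commg_normal K g h : subgroup K -> normalizes K h -> K g -> K [~ g, h].
Proof. by move=> sK nKh Kg; rewrite commgEl; apply: subM; [|apply: subV|apply: nKh]. Qed.

Lemma commg_normalr K g h : subgroup K -> normalizes K g -> K h -> K [~ g, h].
Proof. by move=> sK nKg Kh; rewrite -invgR; apply: subV => //; apply: commg_normal. Qed.

(** * Commutator identities and commutator subgroups *)

Lemma commMgJ x y g : [~ x * y, g] = [~ x, g] ^ y * [~ y, g].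
Proof. by rewrite !commgEl !conjgE invgM -!mulgA !mulVKg. Qed.

Lemma commgMJ x y g : [~ g, x * y] = [~ g, y] * [~ g, x] ^ y.
Proof. by rewrite -[LHS]invgR commMgJ invgM -conjVg !invgR. Qed.

Lemma commVgJ x g : [~ x^-1, g] = ([~ x, g]^-1) ^ x^-1.
Proof.
apply: (mulgI ([~ x, g] ^ x^-1)).
by rewrite -commMgJ mulgV comm1g -conjMg mulgV conj1g.
Qed.

(** Closure comes from the expansions of [[~ x * y, g]] and [[~ x^-1, g]], whose conjugates stay in
    [K] because [E] normalizes it. Hence commutator conditions can be checked on generators. *)
Lemma subgroup_comm E K : subgroup E -> subgroup K ->
  (forall e, E e -> normalizes K e) ->
  subgroup [set g | E g /\ forall e, E e -> K [~ g, e]].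
Proof.
move=> sE sK nKE; split=> [|g h [Eg Kg] [Eh Kh]|g [Eg Kg]]; split.
- exact: sub1.
- by move=> e _; rewrite comm1g; apply: sub1.
- exact: subM.
- move=> e Ee; rewrite commMgJ; apply: subM; [by []| |exact: Kh].
  by apply: nKE => //; apply: Kg.
- exact: subV.
- move=> e Ee; rewrite commVgJ; apply: nKE; first exact: subV.
  by apply: subV => //; apply: Kg.
Qed.

Lemma generated_comm A E K : subgroup E -> subgroup K ->
  (forall e, E e -> normalizes K e) -> A `<=` E ->
  (forall a e, A a -> E e -> K [~ a, e]) ->
  forall a e, generated A a -> E e -> K [~ a, e].
Proof.
move=> sE sK nKE sAE KAE a e Aa Ee.
have [//|_ Ka] := generated_sub (subgroup_comm sE sK nKE) (A := A) _ Aa; last exact: Ka.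
by move=> b Ab; split; [apply: sAE | move=> c; apply: KAE].
Qed.

Lemma subgroup_commutator A B : subgroup (commutator_subgroup A B).
Proof. exact: subgroup_generated. Qed.

Lemma mem_commutator A B a b : A a -> B b -> commutator_subgroup A B [~ a, b].
Proof. by move=> Aa Bb; apply: sub_generated; exists a => //; exists b. Qed.

Lemma commutator_sub A B K : subgroup K ->
  (forall a b, A a -> B b -> K [~ a, b]) -> commutator_subgroup A B `<=` K.
Proof.
by move=> sK KAB; apply: generated_sub => // _ [a Aa [b Bb <-]]; apply: KAB.
Qed.

Lemma commutator_normalizes A B g :
  normalizes A g -> normalizes B g -> normalizes (commutator_subgroup A B) g.
Proof.
move=> nAg nBg; apply: generated_normalizes => _ [a Aa [b Bb <-]].
by rewrite conjRg; apply: mem_commutator; [apply: nAg | apply: nBg].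
Qed.

(** * Lower central series and nilpotency *)

Lemma subgroup_lc K n : subgroup K -> subgroup (lower_central K n).
Proof. by case: n => //= n _; apply: subgroup_commutator. Qed.

Lemma lc_normalizes K g n : normalizes K g -> normalizes (lower_central K n) g.
Proof. by move=> nKg; elim: n => //= n IHn; apply: commutator_normalizes. Qed.

Lemma lc_comm K n g h :
  lower_central K n g -> K h -> lower_central K n.+1 [~ g, h].
Proof. exact: mem_commutator. Qed.

Lemma lcS K n : subgroup K -> lower_central K n.+1 `<=` lower_central K n.
Proof.
move=> sK; apply: commutator_sub => [|a b Ka Kb]; first exact: subgroup_lc.
apply: commg_normal => //; first exact: subgroup_lc.
by apply: lc_normalizes; apply: normalizes_self.
Qed.

Lemma lc_anti K m n : subgroup K -> (m <= n)%N ->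
  lower_central K n `<=` lower_central K m.
Proof.
move=> sK /subnK <-; elim: (n - m)%N => // d IHd.
by rewrite addSn; apply: subset_trans IHd; apply: lcS.
Qed.

Lemma lc_sub K n : subgroup K -> lower_central K n `<=` K.
Proof. by move=> sK; apply: (@lc_anti K 0). Qed.

Lemma lc_mono H K n : H `<=` K -> lower_central H n `<=` lower_central K n.
Proof.
move=> sHK; elim: n => //= n IHn; apply: commutator_sub => [|a b Ha Hb].
  exact: subgroup_commutator.
by apply: mem_commutator; [apply: IHn | apply: sHK].
Qed.

Lemma nilpotentP K : subgroup K ->
  nilpotent_group K <-> exists n, lower_central K n `<=` [set 1].
Proof.
move=> sK; split=> -[n Kn]; exists n; first by rewrite Kn.
by apply/seteqP; split=> // _ ->; apply: sub1; apply: subgroup_lc.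
Qed.

Lemma nilpotent_sub H K : subgroup H -> subgroup K -> H `<=` K ->
  nilpotent_group K -> nilpotent_group H.
Proof.
move=> sH sK sHK /(nilpotentP sK)[n Kn]; apply/nilpotentP => //; exists n.
by apply: subset_trans Kn; apply: lc_mono.
Qed.

Lemma nilpotent_central_series (T : nat -> set G) K n : subgroup K ->
  (forall i, subgroup (T i)) -> K `<=` T 0 ->
  (forall i g h, T i g -> K h -> T i.+1 [~ g, h]) -> T n `<=` [set 1] ->
  nilpotent_group K.
Proof.
move=> sK sT KT0 TK Tn; apply/nilpotentP => //; exists n.
apply: subset_trans Tn; elim: n => //= n IHn.
by apply: commutator_sub => // a b /IHn; apply: TK.
Qed.

Lemma abelian_nilpotent K : subgroup K ->
  (forall g h, K g -> K h -> commute g h) -> nilpotent_group K.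
Proof.
move=> sK cK; apply/nilpotentP => //; exists 1%N.
apply: commutator_sub => [|a b Ka Kb]; first exact: subgroup1.
exact/eqP/commgP/cK.
Qed.

Lemma fitting A B E : subgroup A -> subgroup B -> subgroup E ->
  A `<=` E -> B `<=` E ->
  (forall e, E e -> normalizes A e) -> (forall e, E e -> normalizes B e) ->
  (forall e, E e -> exists a b, [/\ A a, B b & e = a * b]) ->
  nilpotent_group A -> nilpotent_group B -> nilpotent_group E.
Proof.
move=> sA sB sE AE BE nAE nBE EAB /(nilpotentP sA)[m Am] /(nilpotentP sB)[n Bn].
(* The index is shifted by one so that weight 0 means no condition beyond membership in [E]. *)
pose f K i := if i is j.+1 then lower_central K j else E.
have sf K i : subgroup K -> subgroup (f K i) by case: i => // i; apply: subgroup_lc.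
have nf K i e : (forall e, E e -> normalizes K e) -> E e -> normalizes (f K i) e.
  by case: i => [|i] nKE Ee /=; [apply: normalizes_self | apply: lc_normalizes; apply: nKE].
have fE K i : subgroup K -> K `<=` E -> f K i `<=` E.
  by case: i => [|i] sK KE //=; apply: subset_trans KE; apply: lc_sub.
have fS K i g k : subgroup K -> (forall e, E e -> normalizes K e) ->
    f K i g -> K k -> f K i.+1 [~ g, k].
  case: i => [|i] sK nKE /= Kg Kk; last exact: lc_comm.
  by apply: commg_normalr => //; apply: nKE.
have f0 K i j : subgroup K -> lower_central K i `<=` [set 1] -> (i < j)%N ->
    f K j `<=` [set 1].
  by move=> sK K1; case: j => // j lij; apply: subset_trans K1; apply: lc_anti.
(* The groups generated by the [S k] form a central series of [E]: a commutator with an element of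
   [A] raises [i], one with an element of [B] raises [j]. At weight [m + n + 1] either [i > m] or
   [j > n], so the term is trivial. *)
pose S k := [set g | exists i j, [/\ (i + j = k)%N, f A i g & f B j g]].
have SE k : S k `<=` E by move=> g [i [j [_ Ag _]]]; apply: (fE A i).
have nS k e : E e -> normalizes (generated (S k)) e.
  move=> Ee; apply: generated_normalizes => a [i [j [ijk Aa Ba]]].
  by apply: sub_generated; exists i, j; split=> //; apply: nf.
apply: (@nilpotent_central_series (fun k => generated (S k)) E (m + n).+1) => //.
- by move=> i; apply: subgroup_generated.
- by move=> e Ee; apply: sub_generated; exists 0%N, 0%N.
- move=> k; apply: generated_comm => //; [exact: subgroup_generated | exact: nS |].
  move=> g e [i [j [ijk Ag Bg]]] Ee; have [a [b [Aa Bb ->]]] := EAB e Ee.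
  rewrite commgMJ; apply: subM (subgroup_generated _) _ _.
    apply: sub_generated; exists i, j.+1; split; rewrite ?addnS ?ijk //.
      by apply: commg_normal => //; [apply: sf | apply: nf => //; apply: BE].
    exact: fS.
  apply: nS; first exact: BE.
  apply: sub_generated; exists i.+1, j; split; rewrite ?addSn ?ijk //.
    exact: fS.
  by apply: commg_normal => //; [apply: sf | apply: nf => //; apply: AE].
apply: generated_sub; first exact: subgroup1.
move=> g [i [j [ijk Ag Bg]]]; case: (ltnP m i) => lmi; first by apply: (f0 A m i).
apply: (f0 B n j) => //; rewrite ltnNge; apply/negP => ljn.
by have := leq_add lmi ljn; rewrite ijk ltnn.
Qed.

End Subgroups.

(** * Quotient groups *)

Section Quotient.
Variables (G : groupType) (N : set G) (nN : normal_subgroup N).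
Implicit Types g h : G.

Let sN : subgroup N := proj1 nN.

Definition lcoset g : set G := [set h | N (g^-1 * h)].

(** Elements are cosets viewed as sets, so that equality is extensional. The normality proof is a
    parameter of the type, on which the group structure can then depend. *)
Definition quotient of normal_subgroup N : Type :=
  {A : set G | exists g, A = lcoset g}.

HB.instance Definition _ := gen_eqMixin (quotient nN).
HB.instance Definition _ := gen_choiceMixin (quotient nN).

Definition qclass g : quotient nN := exist _ (lcoset g) (ex_intro _ g erefl).

Lemma qclassP g h : qclass g = qclass h <-> N (g^-1 * h).
Proof.
split=> [[/predeqP/(_ h)[_ Ngh]]|Ngh].
  by apply: Ngh; rewrite /lcoset /= mulVg; apply: sub1.
apply: eq_exist => /=; apply/seteqP; split=> k; rewrite /lcoset /= => Nk.
  have -> : h^-1 * k = (g^-1 * h)^-1 * (g^-1 * k) by rewrite invgM invgK -mulgA mulVKg.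
  by apply: subM => //; apply: subV.
by rewrite -(mulVKg h k) [_ * (h * _)]mulgA; apply: subM.
Qed.

Definition qrepr (a : quotient nN) : G := sval (cid (svalP a)).

Lemma qreprK a : qclass (qrepr a) = a.
Proof.
apply: eq_sig_hprop => [A p q|]; first exact: Prop_irrelevance.
by rewrite /= -(svalP (cid (svalP a))).
Qed.

Definition qmul a b := qclass (qrepr a * qrepr b).

Lemma qmulE g h : qmul (qclass g) (qclass h) = qclass (g * h).
Proof.
apply/qclassP; set g' := qrepr _; set h' := qrepr _.
have Ng : N (g'^-1 * g) by apply/qclassP; rewrite qreprK.
have Nh : N (h'^-1 * h) by apply/qclassP; rewrite qreprK.
have -> : (g' * h')^-1 * (g * h) = (g'^-1 * g) ^ h' * (h'^-1 * h).
  by rewrite conjgE invgM -!mulgA mulVKg.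
by apply: subM => //; apply: (proj2 nN).
Qed.

Definition qinv a := qclass (qrepr a)^-1.

Lemma qmulA : associative qmul.
Proof.
move=> a b c; rewrite -(qreprK a) -(qreprK b) -(qreprK c).
by rewrite !qmulE mulgA.
Qed.

Lemma qmul1 : left_id (qclass 1) qmul.
Proof. by move=> a; rewrite -(qreprK a) qmulE mul1g. Qed.

Lemma qmulr1 : right_id (qclass 1) qmul.
Proof. by move=> a; rewrite -(qreprK a) qmulE mulg1. Qed.

Lemma qmulV : left_inverse (qclass 1) qinv qmul.
Proof. by move=> a; rewrite -[X in qmul _ X]qreprK qmulE mulVg. Qed.

Lemma qmulrV : right_inverse (qclass 1) qinv qmul.
Proof. by move=> a; rewrite -[X in qmul X _]qreprK qmulE mulgV. Qed.

HB.instance Definition _ :=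
  isGroup.Build (quotient nN) qmulA qmul1 qmulr1 qmulV qmulrV.

HB.instance Definition _ :=
  isUMagmaMorphism.Build G (quotient nN) qclass
    (erefl, fun g h => esym (qmulE g h)).

Lemma qclass_eq1 g : qclass g = 1 <-> N g.
Proof.
split=> [e|Ng].
  have /qclassP : qclass 1 = qclass g by rewrite e.
  by rewrite invg1 mul1g.
by suff /esym : qclass 1 = qclass g by []; apply/qclassP; rewrite invg1 mul1g.
Qed.

End Quotient.

(** Later arguments see the quotient only through a morphism with kernel [N]. *)
Lemma quotient_morphism (G : groupType) (N : set G) : normal_subgroup N ->
  exists (Q : groupType) (f : UMagmaMorphism.type G Q), forall g, f g = 1 <-> N g.
Proof.
move=> nN; exists (quotient nN); exists (@qclass G N nN) => g.
exact: qclass_eq1.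
Qed.

(** * Periodic elements of nilpotent groups *)

Section Powers.
Variable G : groupType.
Implicit Types (a b c : G) (m n : nat).

Lemma expg_gcd c m n : c ^+ m = 1 -> c ^+ n = 1 -> c ^+ gcdn m n = 1.
Proof.
move=> cm cn; case: (posnP m) => [->|m_gt0]; first by rewrite gcd0n.
have [u v e _] := egcdnP n m_gt0.
have : c ^+ (u * m) = 1 by rewrite mulnC expgnA cm expg1n.
by rewrite e expgnDr mulnC expgnA cn expg1n mul1g.
Qed.

Lemma expg_coprime c m n : coprime m n -> c ^+ m = 1 -> c ^+ n = 1 -> c = 1.
Proof. by move=> /eqP co cm cn; have := expg_gcd cm cn; rewrite co. Qed.

Lemma commXg_commute a b n : commute a [~ a, b] -> [~ a ^+ n, b] = [~ a, b] ^+ n.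
Proof.
move=> ac; rewrite commgEl conjXg.
have -> : a ^ b = a * [~ a, b] by rewrite commgEl mulVKg.
by rewrite expgMn // mulKg.
Qed.

Lemma commgX_commute a b n : commute b [~ a, b] -> [~ a, b ^+ n] = [~ a, b] ^+ n.
Proof.
move=> bc; rewrite -[LHS]invgR commXg_commute; last first.
  by rewrite -invgR; apply: commuteV.
by rewrite -[in LHS]invgR expVgn invgK.
Qed.

Lemma commute_coprime a b m n : commute a [~ a, b] -> commute b [~ a, b] ->
  coprime m n -> a ^+ m = 1 -> b ^+ n = 1 -> commute a b.
Proof.
move=> ac bc co am bn; apply/commgP/eqP; apply: (expg_coprime co).
  by rewrite -commXg_commute // am comm1g.
by rewrite -commgX_commute // bn commg1.
Qed.

End Powers.

Section PiElements.
Variable G : groupType.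
Implicit Types (A B H K L M N : set G) (a b g h : G) (m n : nat) (pi : nat_pred).

Lemma lc_normal_subgroup K n : normal_subgroup K -> normal_subgroup (lower_central K n).
Proof.
move=> [sK nK]; split=> [|g h Kg]; first exact: subgroup_lc.
by apply: lc_normalizes Kg => k Kk; apply: nK.
Qed.

(** By induction [[~ a, b]] lies in every lower central term of [M]: modulo the next term it is
    central in the image of [M], so its order divides both [m] and [n]. *)
Lemma nilpotent_coprime_commute M a b m n : normal_subgroup M -> nilpotent_group M ->
  coprime m n -> M a -> M b -> a ^+ m = 1 -> b ^+ n = 1 -> commute a b.
Proof.
move=> nM nilM co Ma Mb am bn; have sM := proj1 nM.
suff Mc i : lower_central M i [~ a, b].
  by have [k Mk] := nilM; have := Mc k; rewrite Mk => /eqP/commgP.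
elim: i => [|i IHi]; first by apply: commg_normal => //; apply: normalizes_self.
have [Q [f fP]] := quotient_morphism (lc_normal_subgroup i.+1 nM).
suff : commute (f a) (f b) by move=> /commgP/eqP; rewrite -gmulfR => /fP.
have comm_f d : M d -> commute (f d) [~ f a, f b].
  move=> Md; apply/commute_sym/commgP/eqP; rewrite -!gmulfR; apply/fP.
  exact: lc_comm.
by apply: (commute_coprime (m := m) (n := n)) => //;
  rewrite ?comm_f -?gmulfXn ?am ?bn ?gmulf1 //; apply: comm_f.
Qed.

Definition pi_elt pi g := exists m, pi.-nat m /\ g ^+ m = 1.

(** Modulo [N] the group [A] is abelian, so its elements killed by a [pi]-number form a subgroup. *)
Lemma power_generated pi A B N : subgroup A -> normal_subgroup N ->
    (forall g h, A g -> A h -> N [~ g, h]) -> B `<=` A ->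
    (forall b, B b -> exists m, pi.-nat m /\ N (b ^+ m)) ->
  forall a, generated B a -> exists m, pi.-nat m /\ N (a ^+ m).
Proof.
move=> sA nN NA BA NB; have [Q [f fP]] := quotient_morphism nN.
suff : generated B `<=` [set a | A a /\ exists m, pi.-nat m /\ N (a ^+ m)].
  by move=> S a /S[].
apply: generated_sub => [|b Bb]; last by split; [apply: BA | apply: NB].
split=> [|g h [Ag [m [pm gm]]] [Ah [n [pn hn]]]|g [Ag [m [pm gm]]]]; split.
- exact: sub1.
- by exists 1%N; split=> //; rewrite expg1n; apply: sub1 (proj1 nN).
- exact: subM.
- exists (m * n)%N; split; first by rewrite pnatM pm.
  have cgh : commute (f g) (f h).
    by apply/commgP/eqP; rewrite -gmulfR; apply/fP/NA.
  move/fP: gm; move/fP: hn; rewrite !gmulfXn => hn gm.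
  apply/fP; rewrite gmulfXn gmulfM expgMn // expgnA gm expg1n mul1g.
  by rewrite mulnC expgnA hn expg1n.
- exact: subV.
- by exists m; split=> //; rewrite expVgn; apply: subV (proj1 nN) _.
Qed.

Lemma pi_elt_nilpotent pi B : normal_subgroup (generated B) ->
  nilpotent_group (generated B) -> (forall b, B b -> pi_elt pi b) ->
  forall g, generated B g -> pi_elt pi g.
Proof.
move=> nL nilL piB; set L := generated B in nL nilL *; have sL := proj1 nL.
have lcN i := lc_normal_subgroup i nL.
have comm_lc i g h : lower_central L i g -> lower_central L i h ->
    lower_central L i.+1 [~ g, h].
  by move=> Lg Lh; apply: lc_comm => //; apply: lc_sub Lh.
(* Each factor of the lower central series is [pi]-torsion. A factor is generated by commutators
   [[~ a, b]] with [a] one term higher, and [[~ a, b] ^+ m] agrees with [[~ a ^+ m, b]] modulo the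
   following term. *)
have step i g : lower_central L i g ->
    exists m, pi.-nat m /\ lower_central L i.+1 (g ^+ m).
  elim: i g => [|i IHi].
    apply: (power_generated (A := L)) => // [|b|b /piB[m [pm bm]]].
    - exact: (comm_lc 0).
    - exact: sub_generated.
    - by exists m; split=> //; rewrite bm; apply: sub1; apply: subgroup_lc.
  apply: (power_generated (A := lower_central L i.+1)) => //.
  - exact: subgroup_lc.
  - exact: comm_lc.
  - by move=> _ [a La [b Lb <-]]; apply: lc_comm.
  move=> _ [a La [b Lb <-]]; have [m [pm am]] := IHi a La; exists m; split=> //.
  have [Q [f fP]] := quotient_morphism (lcN i.+2).
  apply/fP; rewrite gmulfXn gmulfR -commXg_commute; last first.
    rewrite -gmulfR; apply/commute_sym/commgP/eqP; rewrite -gmulfR; apply/fP.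
    by apply: lc_comm; [apply: lc_comm | apply: lc_sub La].
  by rewrite -gmulfXn -gmulfR; apply/fP; apply: lc_comm.
move=> g Lg; have [n Ln] := nilL.
suff [m [pm gm]] : exists m, pi.-nat m /\ lower_central L n (g ^+ m).
  by exists m; split=> //; move: gm; rewrite Ln.
elim: n {Ln} => [|n [m [pm gm]]]; first by exists 1%N.
have [k [pk gk]] := step n _ gm.
by exists (m * k)%N; rewrite pnatM pm expgnA.
Qed.

Lemma subgroup_pi_elt pi M : normal_subgroup M -> nilpotent_group M ->
  normal_subgroup [set g | M g /\ pi_elt pi g].
Proof.
move=> [sM nM] nilM; set H := [set g | _].
have nH g : normalizes H g.
  move=> h [Mh [m [pm hm]]]; split; first exact: nM.
  by exists m; split=> //; rewrite -conjXg hm conj1g.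
(* The set [H] is a subgroup because it equals the subgroup it generates, all of whose elements are
   again [pi]-elements. *)
have LM : generated H `<=` M by apply: generated_sub => // h [].
have HL : H = generated H.
  apply/seteqP; split=> [h Hh|h Lh]; first exact: sub_generated.
  split; first exact: LM.
  apply: pi_elt_nilpotent Lh => [||b []//].
  - split=> [|x g Lx]; first exact: subgroup_generated.
    apply: (generated_normalizes _ Lx) => a Ha.
    by apply: sub_generated; apply: nH.
  - by apply: nilpotent_sub nilM => //; apply: subgroup_generated.
split=> [|g h Hg]; last exact: nH.
by rewrite HL; apply: subgroup_generated.
Qed.

End PiElements.

(** * Actions on abelian groups *)

Section AbelianAction.
Variables (G : groupType) (A : set G).
Hypotheses (sA : subgroup A) (cA : forall a b, A a -> A b -> commute a b).
Implicit Types (a b x y z : G) (m n p q : nat).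

(* Averaging the cocycle [c j = x^-j (x z)^j]: since [c (j+1) = (c j)^x z] and
   [c q = c 0 = 1], the product [w] of the [c j] satisfies [z^q = [x, w]]. *)
Lemma coprime_complement_conj x z q m : normalizes A x -> A z -> (0 < q)%N ->
    coprime q m -> x ^+ q = 1 -> (x * z) ^+ q = 1 -> z ^+ m = 1 ->
  exists2 v, A v & z = [~ x, v].
Proof.
move=> nAx Az q_gt0 co xq xzq zm.
pose c j := x ^- j * (x * z) ^+ j.
have cS j : c j.+1 = c j ^ x * z.
  by rewrite /c !expgSr invgM conjgE -!mulgA.
have Ac j : A (c j).
  elim: j => [|j IHj]; first by rewrite /c invg1 mulg1; apply: sub1.
  by rewrite cS; apply: subM => //; apply: nAx.
pose w n := \prod_(j < n) c j.
have Aw n : A (w n).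
  by rewrite /w; elim/big_ind: _ => [|u v Au Av|j _]; [apply: sub1|apply: subM|].
have wE n : w n ^ x * z ^+ n = w n * c n.
  elim: n => [|n IHn]; first by rewrite /w !big_ord0 conj1g /c invg1 !mulg1.
  have wS : w n.+1 = w n * c n by rewrite /w big_ord_recr.
  have cJ : c n ^ x * z ^+ n.+1 = z ^+ n * c n.+1.
    by rewrite expgS mulgA -cS; apply: cA => //; apply: subX.
  by rewrite {1}wS conjMg -mulgA cJ mulgA IHn wS.
have zq : z ^+ q = [~ x, w q].
  have e := wE q; rewrite /c xq xzq invg1 !mulg1 in e.
  by rewrite commgEr conjVg -[X in _ * X]e mulKg.
have [u v e _] := egcdnP m q_gt0.
exists (w q ^+ u); first exact: subX.
rewrite commgX_commute; last first.
  by rewrite -zq; apply: cA => //; apply: subX.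
rewrite -zq -expgnA mulnC e (eqP co) expgnDr mulnC expgnA zm expg1n mul1g //.
Qed.

(** Binomial expansion of [y ^+ n] acting on the abelian group [A]: writing [y] as [1 + (y - 1)],
    iterated commutation with [y] is a power of [y - 1]. *)
Lemma conjX_prod a y n : normalizes A y -> A a ->
  a ^ (y ^+ n) = \prod_(j < n.+1) iter j (fun b => [~ b, y]) a ^+ 'C(n, j).
Proof.
move=> nAy Aa; pose d j := iter j (fun b => [~ b, y]) a.
have Ad j : A (d j) by elim: j => //= j IHj; apply: commg_normal.
have dJ j : d j ^ y = d j * d j.+1 by rewrite /d /= commgEl mulVKg.
elim: n => [|n IHn]; first by rewrite big_ord_recl big_ord0 conjg1 mulg1.
rewrite expgSr conjgM IHn conjg_prod.
under eq_bigr => j _ do rewrite conjXg (dJ j) (expgMn _ (cA (Ad j) (Ad j.+1))).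
rewrite prodgM_commute => [|i j _ _]; last by apply: cA; apply: subX.
rewrite [RHS]big_ord_recl [in RHS]bin0.
under [in RHS]eq_bigr => i _ do rewrite lift0 binS expgnDr.
rewrite prodgM_commute => [|i j _ _]; last by apply: cA; apply: subX => //; apply: (Ad (bump 0 _)).
rewrite mulgA; congr (_ * _).
rewrite [in RHS]big_ord_recr /= bin_small // mulg1.
by rewrite big_ord_recl bin0.
Qed.

(* In characteristic [p], [(y - 1)^p = y^p - 1]. *)
Lemma iter_commg_prime a y p : prime p -> normalizes A y -> A a -> a ^+ p = 1 ->
  iter p (fun b => [~ b, y]) a = [~ a, y ^+ p].
Proof.
move=> p_pr nAy Aa ap; rewrite commgEl conjX_prod //.
have dp j : A (iter j (fun b => [~ b, y]) a) /\ iter j (fun b => [~ b, y]) a ^+ p = 1.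
  elim: j => //= j [Ad dp]; split; first exact: commg_normal.
  rewrite commgEl expgMn; last by apply: cA; [apply: subV | apply: nAy].
  by rewrite expVgn -conjXg dp conj1g invg1 mulg1.
case: p p_pr {ap} dp => // p p_pr dp.
rewrite big_ord_recr big_ord_recl binn bin0 big1 => [|i _].
  by rewrite /= !expg1 Monoid.mulm1 mulKg.
have : p.+1 %| 'C(p.+1, bump 0 i).
  by apply: prime_dvd_bin => //; rewrite /bump /= add1n ltnS ltn_ord.
by case/dvdnP=> k ->; rewrite mulnC expgnA (dp (bump 0 i)).2 expg1n.
Qed.

(** The identity for [p] is iterated: [p ^ k.+1] commutations with [x] are [p] blocks, each of which
    acts as one commutation with [x ^+ (p ^ k)]. *)
Lemma iter_commg_pexp a x p k : prime p -> normalizes A x -> A a -> a ^+ p = 1 ->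
  iter (p ^ k) (fun b => [~ b, x]) a = [~ a, x ^+ (p ^ k)].
Proof.
move=> p_pr nAx Aa ap; elim: k a Aa ap => [|k IHk] a Aa ap.
  by rewrite expn0 expg1.
rewrite expnS mulnC expgnA; set y := x ^+ (p ^ k).
have nAy : normalizes A y by apply: normalizesX.
rewrite -iter_commg_prime // mulnC.
suff H j : [/\ A (iter j (fun b => [~ b, y]) a), iter j (fun b => [~ b, y]) a ^+ p = 1 &
    iter (j * p ^ k) (fun b => [~ b, x]) a = iter j (fun b => [~ b, y]) a].
  by have [] := H p.
elim: j => //= j [Ad dp e]; split; first exact: commg_normal.
  rewrite commgEl expgMn; last by apply: cA; [apply: subV | apply: nAy].
  by rewrite expVgn -conjXg dp conj1g invg1 mulg1.
by rewrite mulSn iterD e IHk.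
Qed.

(** The operator [x - 1] is nilpotent on elements of exponent [p], so the last nontrivial iterated
    commutator is fixed by [x]. *)
Lemma exists_fixed a x p k : prime p -> normalizes A x -> A a -> a ^+ p = 1 ->
    x ^+ (p ^ k) = 1 -> a <> 1 ->
  exists n, let b := iter n (fun b => [~ b, x]) a in b <> 1 /\ [~ b, x] = 1.
Proof.
move=> p_pr nAx Aa ap xq a1.
have ex : exists n, iter n (fun b => [~ b, x]) a == 1.
  by exists (p ^ k)%N; rewrite iter_commg_pexp // xq commg1.
case: (ex_minnP ex) => -[|n] /eqP //= an1 min; exists n; split=> //= /eqP/min.
by rewrite ltnn.
Qed.

End AbelianAction.

(** * Conjugacy of complements and growth of normalizers *)

Lemma subgroup_image (G Q : groupType) (f : UMagmaMorphism.type G Q) (K : set G) :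
  subgroup K -> subgroup (f @` K).
Proof.
move=> sK; split=> [|_ _ [g Kg <-] [h Kh <-]|_ [g Kg <-]].
- by exists 1; [apply: sub1 | rewrite gmulf1].
- by exists (g * h); [apply: subM | rewrite gmulfM].
- by exists g^-1; [apply: subV | rewrite gmulfV].
Qed.

Lemma normalizes_image (G Q : groupType) (f : UMagmaMorphism.type G Q) (K : set G) g :
  normalizes K g -> normalizes (f @` K) (f g).
Proof.
by move=> nKg _ [h Kh <-]; exists (h ^ g); [apply: nKg | rewrite gmulfJ].
Qed.

Section Growth.
Variable G : groupType.
Implicit Types (A B E H K L M N : set G) (g h x y : G) (m n p q : nat).

Lemma commute_image_lc (Q : groupType) (f : UMagmaMorphism.type G Q) K i :
    subgroup K -> (forall g, lower_central K i.+1 g -> f g = 1) ->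
  forall a b, (f @` lower_central K i) a -> (f @` lower_central K i) b -> commute a b.
Proof.
move=> sK f1 _ _ [g Kg <-] [h Kh <-]; apply/commgP/eqP; rewrite -gmulfR.
by apply: f1; apply: lc_comm => //; apply: lc_sub Kh.
Qed.

(** A conjugacy statement of Schur-Zassenhaus type, by successive approximation along the lower
    central series. Modulo the next term the error [z] equals some [[~ x ^ u, v]], and replacing [u]
    by [u * v] absorbs it. *)
Lemma nilpotent_complement_conj H x h q : normal_subgroup H -> nilpotent_group H ->
    (0 < q)%N -> (forall k, H k -> exists m, coprime q m /\ k ^+ m = 1) ->
    H h -> x ^+ q = 1 -> (x * h) ^+ q = 1 ->
  exists2 u, H u & x * h = x ^ u.
Proof.
move=> nH [n Hn] q_gt0 Hq Hh xq xhq; have sH := proj1 nH.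
suff S i : exists u z, [/\ H u, lower_central H i z & x * h = x ^ u * z].
  by have [u [z [Hu + ->]]] := S n; rewrite Hn => ->; exists u; rewrite ?mulg1.
elim: i => [|i [u [z [Hu Hz xh]]]].
  by exists 1, h; split=> //; [apply: sub1 | rewrite conjg1].
have [Q [f fP]] := quotient_morphism (lc_normal_subgroup i.+1 nH).
have [m [co zm]] := Hq z (lc_sub sH Hz).
have sA := subgroup_image f (subgroup_lc i sH).
have cA : forall a b, (f @` lower_central H i) a -> (f @` lower_central H i) b ->
    commute a b by apply: commute_image_lc => // g /fP.
have [_ [v Hv <-] zv] :
    exists2 v, (f @` lower_central H i) v & f z = [~ f (x ^ u), v].
  apply: (coprime_complement_conj sA cA (q := q) (m := m)) => //.
  - by apply: normalizes_image; apply: lc_normalizes => k Hk; apply: (proj2 nH).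
  - by rewrite -gmulfXn -conjXg xq conj1g gmulf1.
  - by rewrite -gmulfM -xh -gmulfXn xhq gmulf1.
  - by rewrite -gmulfXn zm gmulf1.
exists (u * v), ([~ x ^ u, v]^-1 * z); split.
- by apply: subM => //; apply: lc_sub Hv.
- by apply/fP; rewrite gmulfM gmulfV gmulfR -zv mulVg.
- rewrite xh conjgM; set X := x ^ u.
  by rewrite commgEl invgM invgK -[_ * X * z]mulgA mulVKg.
Qed.

Lemma normalizer_growth M K x p k : prime p -> periodic [set: G] ->
    normal_subgroup M -> nilpotent_group M -> x ^+ (p ^ k) = 1 ->
    (forall g, exists i h, M h /\ g = x ^+ i * h) ->
    subgroup K -> K x -> (forall h, M h -> pi_elt p^' h -> K h) ->
    ~ (forall g, K g) ->
  exists2 y, ~ K y & normalizes K y.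
Proof.
move=> p_pr perG nM [n Mn] xq GM sK Kx MK nK; have sM := proj1 nM.
(* The last lower central term of [M] not contained in [K] is [A]; it is abelian modulo its
   intersection with [K]. *)
have [i iP] : exists i, ~ (lower_central M i `<=` K) /\ lower_central M i.+1 `<=` K.
  apply: contrapT => /forallNP H.
  suff : ~ (lower_central M n `<=` K) by apply; rewrite Mn => _ ->; apply: sub1.
  elim: n {Mn} => [MsK|n IHn MSK]; last exact: (H n).
  apply: nK => g; have [i [m [Mm ->]]] := GM g.
  by apply: subM => //; [apply: subX | apply: MsK].
have [nMK SMK] := iP; set A := lower_central M i.
have sA : subgroup A by apply: subgroup_lc.
have nA g : normalizes A g by apply: lc_normalizes => h; apply: (proj2 nM).
have MSA : lower_central M i.+1 `<=` A by apply: lcS.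
(* Normality in [G] holds because [x] lies in [K] and commutators of [A] with [M] fall into the next
   term, which is inside [K]. *)
have nN : normal_subgroup (A `&` K).
  split=> [|g h [Ah Kh]]; first exact: subgroupI.
  split; first exact: nA.
  have [j [m [Mm ->]]] := GM g; rewrite conjgM.
  have Khx : K (h ^ x ^+ j) by apply: subJ => //; apply: subX.
  rewrite -[_ ^ m](mulVKg (h ^ x ^+ j)) -commgEl; apply: subM => //.
  by apply: SMK; apply: lc_comm => //; apply: nA.
have [Q [f fP]] := quotient_morphism nN.
have [a1 [Aa1 Ka1]] : exists a, A a /\ ~ K a.
  by apply: contrapT => /forallNP H; apply: nMK => a Aa; apply: contrapT => Ka; apply: (H a).
(* The [p]-part of the order of [a1] is such an exponent, since it leaves a [p']-element of [M]. The
   least one yields an element of [A] of order [p] modulo [K]. *)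
have ex : exists j, `[< K (a1 ^+ (p ^ j)) >].
  have [r [r_gt0 a1r _]] := perG a1 I.
  exists (logn p r); apply/asboolP; rewrite -p_part; apply: MK.
    by apply: subX => //; apply: lc_sub Aa1.
  by exists (r`_p^')%N; rewrite part_pnat -expgnA partnC.
have [a0 [Aa0 Ka0 Ka0p]] : exists a, [/\ A a, ~ K a & K (a ^+ p)].
  case: (ex_minnP ex) => -[|j] /asboolP; first by rewrite expg1.
  move=> Kj min; exists (a1 ^+ (p ^ j)); split; first exact: subX.
    by move=> /asboolP/min; rewrite ltnn.
  by rewrite -expgnA -expnSr.
have sfA := subgroup_image f sA.
have cA : forall a b, (f @` A) a -> (f @` A) b -> commute a b.
  by apply: commute_image_lc => // g Mg; apply/fP; split; [apply: MSA | apply: SMK].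
have [|||||j] := exists_fixed sfA cA (a := f a0) (x := f x) (k := k) p_pr.
- exact: normalizes_image.
- by exists a0.
- by rewrite -gmulfXn; apply/fP; split=> //; apply: subX.
- by rewrite -gmulfXn xq gmulf1.
- by move/fP=> [].
have -> : iter j (fun b => [~ b, f x]) (f a0) = f (iter j (fun b => [~ b, x]) a0).
  by elim: j => //= j ->; rewrite gmulfR.
set y := iter j _ a0; have Ay : A y.
  by rewrite /y; elim: (j) => //= j' Aj; apply: commg_normal.
move=> /= [fy1]; rewrite -gmulfR => /fP[_ Kyx]; exists y => [Ky|h Kh].
  by apply: fy1; apply/fP.
(* As [K] is the product of the powers of [x] with its elements in [M], two commutators must be in
   [K]: [[~ y, x]], because [f y] is fixed by [f x], and [[~ y, m]], because it lies in the next
   lower central term. *)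
have [j' [m [Mm eh]]] := GM h.
have Km : K m by apply: (subMl sK (subX j' sK Kx)); rewrite -eh.
rewrite eh conjMg conjXg; apply: subM => //.
  apply: subX => //; rewrite -(mulVKg x (x ^ y)) -commgEl -invgR.
  by apply: subM => //; apply: subV.
rewrite -(mulVKg m (m ^ y)) -commgEl -invgR; apply: subM => //; apply: subV => //.
by apply: SMK; apply: lc_comm.
Qed.

(** Finite order makes [g^-1] a positive power of [g], which gives the reverse inclusion. *)
Lemma periodic_normalizer K g : periodic [set: G] -> normalizes K g -> normalizer K g.
Proof.
move=> perG nKg; apply/seteqP; split=> [_ [h Kh <-]|h Kh]; first exact: nKg.
have [n [n_gt0 gn _]] := perG g I.
have gV : g^-1 = g ^+ n.-1.
  by apply: mulg1_eq; rewrite -expgS prednK.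
exists (h ^ g^-1); last by rewrite conjgKV.
by rewrite gV; apply: normalizesX.
Qed.

Lemma normalizer_normalizes K g : normalizer K g -> normalizes K g.
Proof. by move=> nKg h Kh; rewrite -nKg; exists h. Qed.

End Growth.

(** * Cyclic subgroups *)

Section Cyclic.
Variable G : groupType.
Implicit Types (A B E H K L M N : set G) (g h x y z : G) (i j k m n p q : nat).

Lemma has_order_dvd g n : (0 < n)%N -> g ^+ n = 1 -> exists2 m, has_order g m & m %| n.
Proof.
move=> n_gt0 gn.
have ex : exists m, (0 < m)%N && (g ^+ m == 1) by exists n; rewrite n_gt0 gn eqxx.
case: (ex_minnP ex) => m /andP[m_gt0 /eqP gm] min; exists m.
  split=> // j /andP[j_gt0 ltjm] gj.
  by have := min j; rewrite j_gt0 gj eqxx leqNgt ltjm => /(_ isT).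
have gr : g ^+ (n %% m) = 1.
  by move: gn; rewrite {1}(divn_eq n m) expgnDr mulnC expgnA gm expg1n mul1g.
rewrite /dvdn; case: posnP => // r_gt0.
by have := min (n %% m)%N; rewrite r_gt0 gr eqxx leqNgt ltn_pmod // => /(_ isT).
Qed.

(** If [p] divided the order [n] of [h], then [h ^+ (n / p)] would have order [p]; conversely an
    element of order [p] killed by a [p']-number is trivial. *)
Lemma p'_groupP p H : prime p -> subgroup H ->
  p'_group p H <-> forall h, H h -> pi_elt p^' h.
Proof.
move=> p_pr sH; split=> [[perH noH] h Hh|HH].
  have [n [n_gt0 hn hmin]] := perH h Hh; exists n; split=> //.
  rewrite p'natE //; apply/negP => /dvdnP[m en].
  have m_gt0 : (0 < m)%N by move: n_gt0; rewrite en muln_gt0 => /andP[].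
  apply: (noH (h ^+ m)); first exact: subX.
  split=> [||j /andP[j_gt0 ltjp]]; rewrite ?prime_gt0 -?expgnA -?en //.
  by apply: hmin; rewrite en muln_gt0 m_gt0 j_gt0 ltn_pmul2l.
split=> [h /HH[m [pm hm]]|h /HH[m [pm hm]] [_ hp hmin]].
  have [||r] := @has_order_dvd h m => //; last by exists r.
  by case/andP: pm.
apply: (hmin 1%N); first by rewrite prime_gt1.
rewrite expg1; apply: (expg_coprime (m := p) (n := m)) => //.
by rewrite prime_coprime // -p'natE.
Qed.

Lemma subgroup_cyclic x : subgroup (cyclic_subgroup x).
Proof. exact: subgroup_generated. Qed.

Lemma mem_cyclic x i : cyclic_subgroup x (x ^+ i).
Proof. by apply: (subX _ (subgroup_cyclic x)); apply: sub_generated. Qed.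

(** Natural exponents suffice because [x] has finite order wherever this set is used as a
    subgroup. *)
Definition mul_cyclic x L : set G := [set g | exists i l, L l /\ g = x ^+ i * l].

Lemma subgroup_mul_cyclic x n L : (0 < n)%N -> x ^+ n = 1 -> subgroup L ->
  normalizes L x -> subgroup (mul_cyclic x L).
Proof.
move=> n_gt0 xn sL nLx; split=> [|_ _ [i [l [Ll ->]]] [j [l' [Ll' ->]]]|_ [i [l [Ll ->]]]].
- by exists 0%N, 1; rewrite mulg1; split=> //; apply: sub1.
- exists (i + j)%N, (l ^ (x ^+ j) * l'); split.
    by apply: subM => //; apply: normalizesX.
  by rewrite expgnDr conjgE -!mulgA mulVKg.
have xiV : (x ^+ i)^-1 = x ^+ (i * n.-1).
  by apply: mulg1_eq; rewrite -expgnDr -mulnS prednK // mulnC expgnA xn expg1n.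
exists (i * n.-1)%N, (l^-1 ^ (x ^+ (i * n.-1))); split.
  by apply: normalizesX => //; apply: subV.
by rewrite -xiV conjgE invgM invgK mulKg.
Qed.

Lemma cyclicP x n y : (0 < n)%N -> x ^+ n = 1 ->
  cyclic_subgroup x y <-> exists i, y = x ^+ i.
Proof.
move=> n_gt0 xn; split=> [xy|[i ->]]; last exact: mem_cyclic.
have n1 : normalizes [set 1] x by move=> _ ->; rewrite conj1g.
have S := subgroup_mul_cyclic n_gt0 xn (@subgroup1 G) n1.
have [|i [_ [-> ->]]] := generated_sub S _ xy; last by exists i; rewrite mulg1.
by move=> _ ->; exists 1%N, 1; rewrite expg1 mulg1.
Qed.

Lemma mul_normal_exp x h i n H : normal_subgroup H -> H h ->
  exists2 h', H h' & (x ^+ i * h) ^+ n = x ^+ (i * n) * h'.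
Proof.
move=> [sH nH] Hh; elim: n => [|n [h' Hh' e]].
  by exists 1; rewrite ?muln0 ?mulg1 //; apply: sub1.
exists (h' ^ (x ^+ i) * h); first by apply: subM => //; apply: nH.
by rewrite expgSr e mulnS addnC expgnDr conjgE -!mulgA mulVKg.
Qed.

End Cyclic.

(** * From the splitting to the class *)

Section SelfNormalizing.
Variable G : groupType.
Implicit Types (E H K L : set G) (g h u x y : G) (i j m n p q : nat).

Lemma subgroup_normalizer K : periodic [set: G] -> subgroup K -> subgroup (normalizer K).
Proof.
move=> perG sK; split=> [|g h nKg nKh|g nKg].
- by apply: periodic_normalizer => // h; rewrite conjg1.
- by apply: periodic_normalizer => //; apply: normalizesM; apply: normalizer_normalizes.
apply: periodic_normalizer => // h Kh.
by rewrite -nKg in Kh; case: Kh => k Kk <-; rewrite conjgK.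
Qed.

Lemma nilpotent_conj K u : subgroup K -> nilpotent_group [set h | K (h ^ u)] ->
  nilpotent_group K.
Proof.
move=> sK [n Kn]; apply/nilpotentP => //; exists n => h Kh.
set K' := [set h | _] in Kn; have sK' : subgroup K' by apply: subgroup_preimJ.
suff S : lower_central K n `<=` [set h | lower_central K' n (h ^ u^-1)].
  by have := S h Kh; rewrite /= Kn => /eqP; rewrite conjg_eq1 => /eqP.
elim: n {Kn h Kh} => [|n IHn] => [h Kh|]; first by rewrite /K' /= conjgKV.
apply: commutator_sub => [|a b /IHn La Kb] /=.
  exact/subgroup_preimJ/subgroup_commutator.
by rewrite conjRg; apply: mem_commutator => //; rewrite /K' /= conjgKV.
Qed.

(** As [x] centralizes [L], both [L] and the cyclic group of [x] are normal in [E], and Fitting's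
    theorem applies. *)
Lemma nilpotent_mul_cyclic x n L E : (0 < n)%N -> x ^+ n = 1 ->
    subgroup L -> nilpotent_group L -> (forall l, L l -> commute x l) ->
    subgroup E -> L `<=` E -> E x ->
    (forall g, E g -> exists i l, L l /\ g = x ^+ i * l) ->
  nilpotent_group E.
Proof.
move=> n_gt0 xn sL nilL cxL sE LE Ex EL.
have cyc y : cyclic_subgroup x y -> exists i, y = x ^+ i by move/(cyclicP _ n_gt0 xn).
have nLE e : E e -> normalizes L e.
  move=> /EL[i [l [Ll ->]]] h Lh; rewrite conjgM.
  have -> : h ^ (x ^+ i) = h.
    by apply/conjg_fixP/commgP; apply/commuteX/commute_sym/cxL.
  exact: subJ.
apply: (fitting (subgroup_cyclic x) sL sE) => //.
- by apply: generated_sub => // _ ->.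
- move=> _ /EL[i [l [Ll ->]]] _ /cyc[j ->].
  have -> : (x ^+ j) ^ (x ^+ i * l) = x ^+ j; last exact: mem_cyclic.
  apply/conjg_fixP/commgP/commuteM; first exact/commuteX2/commute_refl.
  by apply/commute_sym/commuteX/commute_sym/cxL.
- by move=> _ /EL[i [l [Ll ->]]]; exists (x ^+ i), l; split=> //; apply: mem_cyclic.
- apply: abelian_nilpotent => [|_ _ /cyc[i ->] /cyc[j ->]]; first exact: subgroup_cyclic.
  exact/commuteX2/commute_refl.
Qed.

Lemma iter_rho_mem x K n (k : G) : subgroup K -> normalizes K x -> K k -> K (iter n (rho x) k).
Proof.
by move=> sK nKx Kk; elim: n => //= n IHn; apply: commg_normalr.
Qed.

(* If [c = [x, k]] commutes with [x] then [(x c)^q = c^q], while [x c = x ^ k]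
   has the order of [x]. *)
Lemma coprime_rho_iter H x q n (k : G) : subgroup H -> normalizes H x -> x ^+ q = 1 ->
    (forall h, H h -> exists m, coprime q m /\ h ^+ m = 1) ->
  H k -> iter n (rho x) k = 1 -> rho x k = 1.
Proof.
move=> sH nHx xq Hq Hk; elim: n => [/= ->|n IHn]; first by rewrite /rho commg1.
case: n IHn => [//|n] IHn e; apply: IHn => //=; set h := iter n _ k in e *.
have Hh : H h by apply: iter_rho_mem.
have Hc : H (rho x h) by apply: commg_normalr.
have [m [co cm]] := Hq _ Hc; apply: (expg_coprime co) cm.
have /commgP cxc : [~ x, rho x h] == 1 by apply/eqP.
have : (x * rho x h) ^+ q = 1.
  by rewrite /rho commgEl mulVKg -conjXg xq conj1g.
by rewrite expgMn // xq mul1g.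
Qed.

Lemma star_self_normalizing x H K q : periodic [set: G] -> (0 < q)%N -> x ^+ q = 1 ->
    normal_subgroup H -> nilpotent_group H ->
    (forall h, H h -> exists m, coprime q m /\ h ^+ m = 1) ->
    (forall g, exists i h, H h /\ g = x ^+ i * h) ->
    property_star x H -> subgroup K -> K x -> ~ nilpotent_group K ->
  forall g, normalizer K g -> K g.
Proof.
move=> perG q_gt0 xq [sH nH] nilH Hq GH star sK Kx nnK.
have nHx y : normalizes H y by move=> h; apply: nH.
have sHK := subgroupI sH sK.
have KE g : K g -> exists i l, (H `&` K) l /\ g = x ^+ i * l.
  move=> Kg; have [i [h [Hh eg]]] := GH g; exists i, h; split=> //; split=> //.
  by apply: (subMl sK (subX i sK Kx)); rewrite -eg.
(* Otherwise, by coprimality, [x] would centralize the intersection of [H] and [K], and [K] would be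
   nilpotent. *)
have noniter n : ~ (forall k : G, H k -> K k -> iter n (rho x) k = 1).
  move=> K1; apply: nnK; apply: (nilpotent_mul_cyclic (x := x) (L := H `&` K) q_gt0) => //.
  - exact: nilpotent_sub nilH.
  - move=> l [Hl Kl]; apply/commgP/eqP.
    exact: (coprime_rho_iter sH (nHx x) xq Hq Hl (K1 l Hl Kl)).
set N := H `&` normalizer K.
have sN : subgroup N by apply: subgroupI => //; apply: subgroup_normalizer.
have NK h : K h -> normalizer K h.
  by move=> Kh; apply: periodic_normalizer => //; apply: normalizes_self.
have invN : invariant_subgroup x N H.
  split=> // [h []//|y k /(cyclicP _ q_gt0 xq)[i ->] [Hk Nk]].
  split; first exact: nH.
  by apply: subJ (subgroup_normalizer perG sK) Nk _; apply: NK; apply: subX.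
have NK' : N `<=` K.
  case: (star N invN) => [[n n_gt0 Nn]|<-].
    case: (noniter n) => k Hk Kk.
    suff : [set iter n (rho x) k | k in N] (iter n (rho x) k) by rewrite Nn.
    by exists k => //; split=> //; apply: NK.
  apply: generated_sub => // _ [h [Hh /normalizer_normalizes Nh] <-].
  rewrite /rho commgEl; apply: subM => //; first exact: subV.
  exact: Nh.
move=> g Ng; have [i [h [Hh eg]]] := GH g; rewrite eg.
apply: subM => //; first exact: subX.
apply: NK'; split=> //; apply: (subMl (subgroup_normalizer perG sK) (g := x ^+ i)).
  by apply: NK; apply: subX.
by rewrite -eg.
Qed.

Lemma semidirect_class_S x H p : periodic [set: G] -> prime p ->
    semidirect (cyclic_subgroup x) H -> p_group p (cyclic_subgroup x) ->
    nilpotent_group H -> p'_group p H -> (forall h, H h -> h ^ (x ^+ p) = h) ->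
    property_star x H ->
  class_S G.
Proof.
move=> perG p_pr [_ nH _ GH0] pgx nilH p'H cxp star K sK nnK.
have [sH nHJ] := nH.
have [k [_ xq _]] := pgx x (sub_generated erefl).
set q := (p ^ k)%N in xq.
have q_gt0 : (0 < q)%N by rewrite expn_gt0 prime_gt0.
have co m : p^'.-nat m -> coprime q m.
  move=> pm; apply: coprimeXl; rewrite prime_coprime // -p'natE //.
have Hq h : H h -> exists m, coprime q m /\ h ^+ m = 1.
  by move/(p'_groupP p_pr sH): p'H => p'H /p'H[m [/co]]; exists m.
have GH g : exists i h, H h /\ g = x ^+ i * h.
  have : [set: G] g by []; rewrite -GH0 => -[_ /(cyclicP _ q_gt0 xq)[i ->] [h Hh <-]].
  by exists i, h.
have [g [Kg nEg]] : exists g, K g /\ ~ (exists i l, H l /\ g = (x ^+ p) ^+ i * l).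
  apply: contrapT => /forallNP H1; apply: nnK.
  have cxpG g : commute (x ^+ p) g.
    have [i [h [Hh ->]]] := GH g; apply: commuteM; first exact/commuteX2/commute_refl.
    by apply/commute_sym/commgP/conjg_fixP/cxp.
  have xpq : (x ^+ p) ^+ q = 1 by rewrite -expgnA mulnC expgnA xq expg1n.
  have nHxp : normalizes H (x ^+ p) by move=> h; apply: nHJ.
  have sE := subgroup_mul_cyclic q_gt0 xpq sH nHxp.
  apply: (@nilpotent_sub _ _ _ sK sE).
    by move=> g Kg; apply: contrapT => nE; apply: (H1 g).
  apply: (nilpotent_mul_cyclic q_gt0 xpq sH nilH) => //.
    by move=> h Hh; exists 0%N, h; rewrite mul1g.
  by exists 1%N, 1; rewrite mulg1 expg1; split=> //; apply: sub1.
have [i [h [Hh eg]]] := GH g.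
have pNi : ~~ (p %| i).
  apply/negP => /dvdnP[j ei]; apply: nEg; exists j, h; split=> //.
  by rewrite -expgnA mulnC -ei.
have [h' Hh' gq] : exists2 h', H h' & g ^+ q = h'.
  have [h' Hh' e] := mul_normal_exp x i q nH Hh; exists h' => //.
  by rewrite eg e mulnC expgnA xq expg1n mul1g.
have [m [pm hm]] : pi_elt p^' h' by apply: (iffLR (p'_groupP p_pr sH) p'H).
have mi_gt0 : (0 < m * i)%N.
  rewrite muln_gt0; case/andP: pm => -> _ /=.
  by case: (i) pNi; rewrite ?dvdn0.
(* Bezout gives [u * (m * i) = v * q + 1]. So [g ^+ (u * m)] lies in the coset of [x] modulo [H],
   and its [q]-th power is 1 because [g ^+ q] is killed by [m]. *)
have [u v euv _] := egcdnP q mi_gt0.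
have gcd1 : gcdn (m * i) q = 1%N.
  apply/eqP; rewrite -[_ == _]/(coprime _ _) coprime_sym coprimeMr co //=.
  by rewrite coprimeXl // prime_coprime.
have [h2 Hh2 eg2] : exists2 h2, H h2 & g ^+ (u * m) = x * h2.
  have [h2 Hh2 e] := mul_normal_exp x i (u * m) nH Hh; exists h2 => //.
  rewrite eg e mulnC -mulnA euv gcd1 expgnDr mulnC expgnA xq expg1n mul1g expg1 //.
have xhq : (x * h2) ^+ q = 1.
  by rewrite -eg2 -expgnA mulnC expgnA gq mulnC expgnA hm expg1n.
have [c Hc xc] := nilpotent_complement_conj nH nilH q_gt0 Hq Hh2 xq xhq.
have Kxc : K (x ^ c) by rewrite -xc -eg2; apply: subX.
(* The argument is applied to the conjugate of [K] by [c^-1], which contains [x], and is carried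
   back to [K] at the end. *)
have selfK := star_self_normalizing perG q_gt0 xq nH nilH Hq GH star
  (subgroup_preimJ c sK) Kxc (fun nK => nnK (nilpotent_conj sK nK)).
apply/seteqP; split=> y Ky; last first.
  by apply: periodic_normalizer => //; apply: normalizes_self.
rewrite -(conjgKV c y); apply: selfK; apply: periodic_normalizer => // l Kl /=.
by rewrite conjJg conjgKV; apply: (normalizer_normalizes Ky).
Qed.

End SelfNormalizing.

(** * From the class to the splitting *)

Section Structure.
Variable G : groupType.
Hypothesis perG : periodic [set: G].
Implicit Types (A B E H K L M : set G) (g h x y : G) (i j m n p : nat).

Lemma subgroup_mulc x L : subgroup L -> normalizes L x -> subgroup (mul_cyclic x L).
Proof.
move=> sL nLx; have [n [n_gt0 xn _]] := perG (g := x) I.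
exact: subgroup_mul_cyclic xn sL nLx.
Qed.

Lemma mulc_sub x L : L `<=` mul_cyclic x L.
Proof. by move=> l Ll; exists 0%N, l; rewrite mul1g. Qed.

Lemma mulc_gen x L : subgroup L -> mul_cyclic x L x.
Proof. by move=> sL; exists 1%N, 1; rewrite mulg1 expg1; split=> //; apply: sub1. Qed.

Lemma class_S_star x H : class_S G -> subgroup H ->
  (forall i, H (x ^+ i) -> x ^+ i = 1) -> property_star x H.
Proof.
move=> SG sH xH1 K [sK KH nKc].
have nKx : normalizes K x by move=> k; apply: nKc; apply: sub_generated.
set L := generated _; have sL : subgroup L by apply: subgroup_generated.
have Lrho k : K k -> L (rho x k) by move=> Kk; apply: sub_generated; exists k.
have LK : L `<=` K.
  by apply: generated_sub => // _ [k Kk <-]; apply: commg_normalr.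
have nLx : normalizes L x.
  apply: generated_normalizes => _ [k Kk <-].
  have -> : rho x k ^ x = rho x (k ^ x) by rewrite /rho conjRg [x ^ x]conjgE mulKg.
  by apply: Lrho; apply: nKx.
have nLK k : K k -> normalizes L k.
  move=> Kk; apply: generated_normalizes => _ [l Kl <-].
  have -> : rho x l ^ k = (rho x k)^-1 * rho x (l * k) by rewrite /rho commgMJ mulKg.
  by apply: (subM sL); [apply: (subV sL)|]; apply: Lrho => //; apply: subM.
have sE := subgroup_mulc sL nLx; have Ex := mulc_gen x sL.
have LE := @mulc_sub x L; set E := mul_cyclic x L in sE Ex LE.
have [nilE|nnE] := pselect (nilpotent_group E).
  (* The first application of [rho x] carries [K] into [L]; the next [n] descend the lower central
     series of [E]. *)
  left; have [n En] := nilE; exists n.+1 => //.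
  have rho1 k : K k -> iter n.+1 (rho x) k = 1.
    move=> Kk; rewrite iterSr; set l := rho x k.
    suff : lower_central E n (iter n (rho x) l) by rewrite En; apply.
    elim: (n) => [|m IHm]; first by apply: LE; apply: Lrho.
    rewrite [iter _ _ _]/= /rho -invgR; apply: (subV (subgroup_lc m.+1 sE)).
    exact: lc_comm.
  apply/seteqP; split=> [_ [k Kk <-]|_ ->]; first exact: rho1.
  by exists 1; [apply: sub1 | apply: rho1; apply: sub1].
right; apply/seteqP; split=> // k Kk.
(* Here [K] normalizes [E], so it lies in [E]. The part of [k] in the cyclic group of [x] then
   belongs to [H], hence is trivial, and [k] is in [L]. *)
have : E k.
  rewrite -(SG E sE nnE); apply: periodic_normalizer => // _ [i [l [Ll ->]]].
  rewrite conjMg conjXg; apply: subM => //; last by apply: LE; apply: nLK.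
  apply: subX => //; have -> : x ^ k = x * rho x k by rewrite /rho commgEl mulVKg.
  by apply: subM => //; apply: LE; apply: Lrho.
move=> [i [l [Ll ek]]]; rewrite ek (xH1 i) ?mul1g //.
by apply: (subMr sH (KH _ (LK _ Ll))); rewrite -ek; apply: KH.
Qed.

(** * Subgroups containing the derived subgroup *)

Let D := commutator_subgroup [set: G] [set: G].

Lemma normalizes_derived K g : subgroup K -> D `<=` K -> normalizes K g.
Proof.
move=> sK DK h Kh; rewrite -(mulVKg h (h ^ g)) -commgEl; apply: subM => //.
by apply: DK; apply: mem_commutator.
Qed.

Lemma class_S_derived K : class_S G -> subgroup K -> D `<=` K ->
  nilpotent_group K \/ forall g, K g.
Proof.
move=> SG sK DK; have [nilK|nnK] := pselect (nilpotent_group K); first by left.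
right=> g; rewrite -(SG K sK nnK); apply: periodic_normalizer => //.
exact: normalizes_derived.
Qed.

Lemma subgroup_derived K n : subgroup K -> subgroup (derived_series K n).
Proof. by case: n => //= n _; apply: subgroup_commutator. Qed.

(** The quotient by [K] is perfect and soluble, hence trivial: every element is congruent to one in
    each term of the derived series. *)
Lemma soluble_mul_derived K : soluble_group [set: G] -> normal_subgroup K ->
  (forall g, exists k d, [/\ K k, D d & g = k * d]) -> forall g, K g.
Proof.
move=> [n Gn] nK GKD g; have [Q [f fP]] := quotient_morphism nK.
suff S m h : exists2 d, derived_series [set: G] m d & f h = f d.
  by have [d + fd] := S n g; rewrite Gn => d1; apply/fP; rewrite fd d1 gmulf1.
elim: m h => [|m IHm] h; first by exists h.
have [k [d [/fP fk Dd ->]]] := GKD h; rewrite gmulfM fk mul1g.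
have sD := subgroup_derived m.+1 (subgroupT G).
move: d Dd; apply: generated_sub => [|_ [a _ [b _ <-]]].
  split=> [|a b [a' Da ea] [b' Db eb]|a [a' Da ea]].
  - by exists 1 => //; apply: (sub1 sD).
  - by exists (a' * b'); [apply: (subM sD) | rewrite !gmulfM ea eb].
  - by exists a'^-1; [apply: (subV sD) | rewrite !gmulfV ea].
have [a' Da ea] := IHm a; have [b' Db eb] := IHm b.
by exists [~ a', b']; [apply: mem_commutator | rewrite !gmulfR ea eb].
Qed.

Lemma nilpotent_join A B : normal_subgroup A -> normal_subgroup B ->
    nilpotent_group A -> nilpotent_group B ->
  exists E, [/\ normal_subgroup E, nilpotent_group E, A `<=` E & B `<=` E].
Proof.
move=> [sA nA] [sB nB] nilA nilB.
exists [set g | exists a b, [/\ A a, B b & g = a * b]]; set E := [set g | _].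
have AE : A `<=` E by move=> a Aa; exists a, 1; rewrite mulg1; split=> //; apply: sub1.
have BE : B `<=` E by move=> b Bb; exists 1, b; rewrite mul1g; split=> //; apply: sub1.
have sE : subgroup E.
  split=> [|_ _ [a [b [Aa Bb ->]]] [c [d [Ac Bd ->]]]|_ [a [b [Aa Bb ->]]]].
  - by apply: AE; apply: sub1.
  - exists (a * c), (b ^ c * d); split; [exact: subM | by apply: subM => //; apply: nB |].
    by rewrite conjgE -!mulgA mulVKg.
  exists a^-1, (b^-1 ^ a^-1); split; [exact: subV | by apply: nB; apply: subV |].
  by rewrite invgM conjgE invgK mulKg.
split=> //; last first.
  by apply: (fitting sA sB sE) => // e _ h; [apply: nA | apply: nB].
split=> // g _ [a [b [Aa Bb ->]]]; exists (a ^ g), (b ^ g).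
by split; [apply: nA | apply: nB | rewrite conjMg].
Qed.

Lemma exists_p_generator : ~ locally_nilpotent [set: G] ->
  exists p k x, [/\ prime p, x ^+ (p ^ k) = 1 & ~ nilpotent_group (mul_cyclic x D)].
Proof.
move=> nlocG; apply: contrapT => nex; apply: nlocG => A finA _.
have sD : subgroup D by apply: subgroup_commutator.
have nilX p k x : prime p -> x ^+ (p ^ k) = 1 -> nilpotent_group (mul_cyclic x D).
  by move=> p_pr xq; apply: contrapT => nn; apply: nex; exists p, k, x.
(* Strong induction on the exponent [n]: a primary element lies in a nilpotent normal
   [mul_cyclic g D], and otherwise the subgroups found for two proper powers of [g] are joined. *)
have nilg n g : (0 < n)%N -> g ^+ n = 1 ->
    exists E, [/\ normal_subgroup E, nilpotent_group E & E g].
  elim/ltn_ind: n g => n IHn g n_gt0 gn; set p := pdiv n.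
  have primary q k : prime q -> n = (q ^ k)%N ->
      exists E, [/\ normal_subgroup E, nilpotent_group E & E g].
    move=> q_pr en; exists (mul_cyclic g D).
    have sE : subgroup (mul_cyclic g D).
      by apply: subgroup_mulc => //; apply: normalizes_derived.
    split; last exact: mulc_gen.
      split=> // h l; apply: normalizes_derived => //; exact: mulc_sub.
    by apply: (nilX q k) => //; rewrite -en.
  have [n1|n_neq1] := eqVneq n 1%N; first exact: (primary 2%N 0%N).
  have p_pr : prime p by apply: pdiv_prime; rewrite ltn_neqAle eq_sym n_neq1.
  have [ep|np] := eqVneq (n`_p)%N n; first by apply: (primary p (logn p n)); rewrite -?p_part.
  have ltp : ((n`_p)%N < n)%N by rewrite ltn_neqAle np dvdn_leq // dvdn_part.
  have ltp' : ((n`_p^')%N < n)%N.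
    rewrite -[X in (_ < X)%N](partnC p n_gt0) ltn_Pmull // p_part.
    by rewrite -(exp1n (logn p n)) ltn_exp2r ?prime_gt1 // logn_gt0 mem_primes p_pr n_gt0 pdiv_dvd.
  have [|A1 [nA nilA Ag]] := IHn _ ltp (g ^+ (n`_p^')%N) (part_gt0 _ _).
    by rewrite -expgnA mulnC partnC.
  have [|A2 [nB nilB Bg]] := IHn _ ltp' (g ^+ (n`_p)%N) (part_gt0 _ _).
    by rewrite -expgnA partnC.
  have [E [nE nilE AE BE]] := nilpotent_join nA nB nilA nilB.
  exists E; split=> //; have sE := proj1 nE.
  (* Bezout recovers [g] from its two powers with coprime exponents. *)
  have [u v e _] := egcdnP (n`_p^')%N (part_gt0 p n).
  rewrite (eqP (coprime_partC p n n)) in e.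
  apply: (subMl sE (g := g ^+ (v * (n`_p^')%N))).
    by rewrite mulnC expgnA; apply: subX => //; apply: AE.
  rewrite -expgSr -addn1 -e mulnC expgnA; apply: subX => //; exact: BE.
have /finite_seqP[s ->] := finA.
suff [E [nE nilE AE]] : exists E, [/\ normal_subgroup E, nilpotent_group E & [set` s] `<=` E].
  apply: nilpotent_sub nilE; [exact: subgroup_generated | exact: (proj1 nE) |].
  exact: generated_sub (proj1 nE) AE.
elim: s => [|a s [B [nB nilB sB]]].
  have [|E [nE nilE _]] := nilg 1%N 1 isT; first by rewrite expg1.
  by exists E; split.
have [n [n_gt0 an _]] := perG (g := a) I.
have [A' [nA nilA Aa]] := nilg n a n_gt0 an.
have [E [nE nilE AE BE]] := nilpotent_join nA nB nilA nilB.
exists E; split=> // b; rewrite /= in_cons => /orP[/eqP->|sb]; first exact: AE.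
by apply: BE; apply: sB.
Qed.

(* A subgroup containing [K0] that is maximal among those not containing the
   finite set [A] is normalized by some element outside it, so it is normal;
   as it contains [x] and [G = <x> G'], it is all of [G] by solubility. *)
Lemma growth_full A x K0 : soluble_group [set: G] -> finite_set A ->
    (forall g, mul_cyclic x D g) -> subgroup K0 -> K0 x ->
    (forall K, subgroup K -> K0 `<=` K -> A `<=` K -> forall g, K g) ->
    (forall K, subgroup K -> K0 `<=` K -> ~ (forall g, K g) ->
       exists2 y, ~ K y & normalizes K y) ->
  forall g, K0 g.
Proof.
move=> solG /finite_seqP[s eA] GD sK0 K0x full grow.
apply: contrapT => nK0.
pose P K := K = set0 \/ [/\ subgroup K, K0 `<=` K & ~ (A `<=` K)].
have PK0 : P K0 by right; split=> // AK0; apply: nK0; apply: full.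
have [|M [PM maxM]] := @Zorn_bigcup G P.
  move=> F FP totF; have [[K1 [FK1 K1n]]|F0] := pselect (exists K, F K /\ K <> set0).
    have FPn K : F K -> (exists g, K g) -> [/\ subgroup K, K0 `<=` K & ~ (A `<=` K)].
      by move=> /FP[->|//] [].
    have [g1 K1g1] : exists g, K1 g by apply/set0P/eqP.
    have [sK1 K01 nAK1] := FPn K1 FK1 (ex_intro _ g1 K1g1).
    have up K K' : F K -> F K' -> exists2 K'', F K'' & K `<=` K'' /\ K' `<=` K''.
      move=> FK FK'; case: (totF K K' FK FK') => KK'.
        by exists K' => //; split=> // g.
      by exists K => //; split=> // g.
    right; split.
    - split=> [|g h [K FK Kg] [K' FK' Kh]|g [K FK Kg]].
      + by exists K1 => //; apply: sub1.
      + have [K2 FK2 [/(_ g Kg) K2g /(_ h Kh) K2h]] := up K K' FK FK'.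
        have [sK2 _ _] := FPn K2 FK2 (ex_intro _ g K2g).
        by exists K2 => //; apply: subM.
      + have [sK _ _] := FPn K FK (ex_intro _ g Kg).
        by exists K => //; apply: subV.
    - by move=> g K0g; exists K1 => //; apply: K01.
    rewrite eA => sF.
    (* If the union contained the finite set [A], a single member of the chain would already contain
       it. *)
    suff [K FK [K1K sK]] : exists2 K, F K & K1 `<=` K /\ [set` s] `<=` K.
      have [_ _ nAK] := FPn K FK (ex_intro _ g1 (K1K _ K1g1)).
      by apply: nAK; rewrite eA.
    elim: s {eA} sF => [|a s IHs] sF; first by exists K1 => //; split=> g.
    have [|K FK [K1K sK]] := IHs; first by move=> b sb; apply: sF; rewrite /= in_cons sb orbT.
    have [|K' FK' K'a] := sF a; first by rewrite /= mem_head.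
    have [K2 FK2 [KK2 K'K2]] := up K K' FK FK'; exists K2 => //; split.
      exact: subset_trans KK2.
    by move=> b; rewrite /= in_cons => /orP[/eqP->|/sK/KK2 //]; apply: K'K2.
  left; apply/seteqP; split=> // g [K FK Kg]; apply: F0; exists K; split=> // K0'.
  by rewrite K0' in Kg.
case: PM => [M0|[sM K0M nAM]].
  apply: (maxM K0) => //; rewrite M0; split=> // /(_ 1); apply; exact: sub1.
have nGM : ~ forall g, M g by move=> MG; apply: nAM => a _.
have [y nMy nMy'] := grow M sM K0M nGM.
have sE := subgroup_mulc sM nMy'.
(* By maximality of [M] the larger subgroup [mul_cyclic y M] contains [A], so it is all of [G]. *)
have GE : forall g, mul_cyclic y M g.
  apply: full => //; first by apply: subset_trans K0M _; apply: mulc_sub.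
  apply: contrapT => nAE; apply: (maxM (mul_cyclic y M)).
    by split=> [|EM]; [apply: mulc_sub | apply/nMy/EM/mulc_gen].
  by right; split=> //; apply: subset_trans K0M _; apply: mulc_sub.
have nM : normal_subgroup M.
  split=> // g h Mh; have [i [l [Ml ->]]] := GE g; rewrite conjgM.
  by apply: subJ => //; apply: normalizesX.
apply: nGM; apply: soluble_mul_derived => // g; have [i [d [Dd ->]]] := GD g.
by exists (x ^+ i), d; split=> //; apply: subX => //; apply: K0M.
Qed.

End Structure.

(** * Construction of the splitting *)

Lemma class_S_semidirect (G : groupType) : periodic [set: G] ->
    soluble_group [set: G] -> ~ locally_nilpotent [set: G] -> class_S G ->
  exists (x : G) (H : set G) (p : nat),
    prime p /\
    semidirect (cyclic_subgroup x) H /\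
    p_group p (cyclic_subgroup x) /\
    nilpotent_group H /\
    p'_group p H /\
    (forall h : G, H h -> h ^ (x ^+ p) = h) /\
    property_star x H.
Proof.
move=> perG solG nlocG SG.
have [p [k [x [p_pr xq nnx]]]] := exists_p_generator perG nlocG.
set D := commutator_subgroup [set: G] [set: G] in nnx.
have sD : subgroup D by apply: subgroup_commutator.
have nD (g : G) : normalizes D g by apply: normalizes_derived.
have GxD : forall g, mul_cyclic x D g.
  have [//|//] := class_S_derived perG SG (subgroup_mulc perG sD (nD x)) (@mulc_sub _ x D).
set M := mul_cyclic (x ^+ p) D.
have sM : subgroup M by apply: subgroup_mulc.
have DM : D `<=` M by apply: mulc_sub.
have nM : normal_subgroup M by split=> // g h; apply: normalizes_derived.
(* If [M] were [G], then [x] would be congruent to [x ^+ (p * j)] modulo [D]. Iterating [k] times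
   puts [x] in [D], so [G] is perfect and soluble, hence trivial, against the choice of [x]. *)
have nilM : nilpotent_group M.
  have [//|GM] := class_S_derived perG SG sM DM.
  have [Q [f fP]] : exists (Q : groupType) (f : UMagmaMorphism.type G Q),
      forall g, f g = 1 <-> D g by apply: quotient_morphism; split=> // g h; apply: nD.
  have [j [d [Dd xd]]] := GM x.
  have fx n : f x = f x ^+ ((p * j) ^ n).
    elim: n => [|n IHn]; first by rewrite expn0 expg1.
    rewrite expnSr expgnA -IHn -gmulfXn {1}xd gmulfM expgnA.
    by move/fP: Dd => ->; rewrite mulg1.
  have Dx : D x.
    apply/fP; rewrite (fx k) expnMn expgnA -gmulfXn xq gmulf1 expg1n //.
  have G1 (g : G) : g = 1.
    have n1 : normal_subgroup [set 1 : G].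
      by split=> [|h l ->]; [apply: subgroup1 | rewrite conj1g].
    apply: (soluble_mul_derived solG n1) => h; exists 1, h; split; rewrite ?mul1g //.
    by have [i [l [Dl ->]]] := GxD h; apply: (subM sD) => //; apply: (subX _ sD).
  case: nnx; apply: abelian_nilpotent; first exact: subgroup_mulc.
  by move=> g h _ _; rewrite (G1 g) (G1 h).
pose H := [set g | M g /\ pi_elt p^' g].
have nH : normal_subgroup H by apply: subgroup_pi_elt.
have [sH nHJ] := nH; have nHg (g : G) : normalizes H g by move=> h; apply: nHJ.
have nilH : nilpotent_group H by apply: nilpotent_sub nilM => // h [].
have co m : p^'.-nat m -> coprime (p ^ k) m.
  by move=> pm; apply: coprimeXl; rewrite prime_coprime // -p'natE.
have q_gt0 : (0 < p ^ k)%N by rewrite expn_gt0 prime_gt0.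
have xH1 i : H (x ^+ i) -> x ^+ i = 1.
  move=> [_ [m [pm xm]]]; apply: (expg_coprime (co m pm)) xm.
  by rewrite -expgnA mulnC expgnA xq expg1n.
have GxH : forall g, mul_cyclic x H g.
  (* A finite set generating a non-nilpotent subgroup forces non-nilpotency of every subgroup
     containing it. Such a subgroup above [mul_cyclic x H] is self-normalizing, so by the growth of
     normalizers it is [G]. *)
  have [A finA nnA] : exists2 A : set G, finite_set A & ~ nilpotent_group (generated A).
    apply: contrapT => nex; apply: nlocG => A finA _.
    by apply: contrapT => nnA; apply: nex; exists A.
  have sK0 := subgroup_mulc perG sH (nHg x); have K0x := mulc_gen x sH.
  have grow K : subgroup K -> mul_cyclic x H `<=` K -> ~ (forall g, K g) ->
      exists2 y, ~ K y & normalizes K y.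
    move=> sK xHK; apply: (normalizer_growth p_pr perG nM nilM xq) => //.
    - by move=> g; have [i [d [Dd ->]]] := GxD g; exists i, d; split=> //; apply: DM.
    - exact: xHK.
    - by move=> h Mh ph; apply: xHK; apply: mulc_sub.
  apply: (growth_full perG solG finA GxD sK0 K0x _ grow) => K sK K0K AK.
  apply: contrapT => nK; have [y nKy nKy'] := grow K sK K0K nK; apply: nKy.
  have nnK : ~ nilpotent_group K.
    move=> nilK; apply: nnA; apply: nilpotent_sub nilK => //; first exact: subgroup_generated.
    exact: generated_sub.
  by rewrite -(SG K sK nnK); apply: periodic_normalizer.
have cyc y : cyclic_subgroup x y -> exists i, y = x ^+ i by move/(cyclicP _ q_gt0 xq).
exists x, H, p; split=> //; split; last (split; last (split=> //; split; last split)).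
- split=> //; first exact: subgroup_cyclic.
    apply/seteqP; split=> [_ [/cyc[i ->] /xH1 //]|_ ->].
    by split; [apply: (sub1 (subgroup_cyclic x)) | apply: sub1].
  apply/seteqP; split=> // g _; have [i [h [Hh ->]]] := GxH g.
  by exists (x ^+ i); [apply: mem_cyclic | exists h].
- move=> _ /cyc[i ->].
  have [||m om] := @has_order_dvd _ (x ^+ i) (p ^ k) => //.
    by rewrite -expgnA mulnC expgnA xq expg1n.
  by case/(dvdn_pfactor _ _ p_pr) => j _ em; exists j; rewrite -em.
- by apply/(p'_groupP p_pr sH) => h [].
(* Both [x ^+ p] and [h] lie in the nilpotent group [M] and are killed by coprime exponents. *)
- move=> h [Mh [m [pm hm]]]; apply/conjg_fixP/commgP.
  apply/commute_sym/(nilpotent_coprime_commute nM nilM (co m pm)) => //.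
    exact: mulc_gen.
  by rewrite -expgnA mulnC expgnA xq expg1n.
- exact: class_S_star.
Qed.

Theorem theorem3p4 (G : groupType)
    (periodicG : periodic [set: G])
    (solubleG : soluble_group [set: G])
    (not_loc_nilG : ~ locally_nilpotent [set: G]) :
  class_S G <->
  exists (x : G) (H : set G) (p : nat),
    prime p /\
    semidirect (cyclic_subgroup x) H /\
    p_group p (cyclic_subgroup x) /\
    nilpotent_group H /\
    p'_group p H /\
    (forall h : G, H h -> h ^ (x ^+ p) = h) /\
    property_star x H.
Proof.
split=> [|[x [H [p [p_pr [sd [pgx [nilH [p'H [cxp star]]]]]]]]]].
  exact: class_S_semidirect.
exact: semidirect_class_S sd pgx nilH p'H cxp star.
Qed.
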